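(* Let $f:X\to Y$ be a continuous map between zero-dimensional locally compact Hausdorff spaces, let $(A,I)=(CO(X),CK(X))$, $(B,J)=(CO(Y),CK(Y))$, and let $\varphi=\Theta^t(f):B\to A$ be given by $\varphi(G)=f^{-1}(G)$. Then $f$ is a dense embedding iff $\varphi$ is an injection and $\varphi(J)\supseteq I$.
   Context: A space is zero-dimensional if its clopen subsets form a base. $CO(X)$ is the Boolean algebra of clopen subsets of $X$ and $CK(X)$ is the set of compact clopen subsets of $X$. A dense embedding is a homeomorphic embedding $f:X\to Y$ with $f(X)$ dense in $Y$. *)

(* Defs.v *)
From mathcomp Require Import all_boot.
From mathcomp Require Import all_classical.
From mathcomp Require Import topology.

Set Implicit Arguments.
Unset Strict Implicit.
Unset Printing Implicit Defensive.

Local Open Scope classical_set_scope.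

(* The library's [zero_dimensional] only asks that distinct points be separated
   by a clopen set, which does not give a base of clopen sets in general. *)
Definition clopen_based (X : topologicalType) : Prop := basis (@clopen X).

(* [CO X] is used both as a set of subsets of [X] and, through the coercion
   [set_type], as the type of clopen subsets of [X]. *)
Definition CO (X : topologicalType) : set (set X) := [set G | clopen G].
Arguments CO : clear implicits.

Definition CK (X : topologicalType) : set (CO X) :=
  [set G | compact (set_val G)].
Arguments CK : clear implicits.

Lemma preimage_CO (X Y : topologicalType) (f : X -> Y) (cf : continuous f)
    (G : CO Y) : f @^-1` set_val G \in CO X.
Proof.
apply/mem_set; case: (set_valP G) => oG cG; split.
  by move/continuousP: cf; apply.
by move/continuous_closedP: cf; apply.
Qed.

Definition Theta_t (X Y : topologicalType) (f : X -> Y) (cf : continuous f) :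
    CO Y -> CO X :=
  fun G => SigSub (preimage_CO cf G).

Definition homeomorphism (X Y : topologicalType) (h : X -> Y) : Prop :=
  continuous h /\
  exists g : Y -> X, [/\ continuous g, cancel h g & cancel g h].

Definition to_range (X Y : Type) (f : X -> Y) : X -> range f :=
  fun x => SigSub (mem_set (imageT f x)).

(* [range f], as a type, carries the subspace topology induced from [Y]. *)
Definition embedding (X Y : topologicalType) (f : X -> Y) : Prop :=
  homeomorphism (to_range f).

Definition dense_embedding (X Y : topologicalType) (f : X -> Y) : Prop :=
  embedding f /\ dense (range f).

(* Main.v *)
Require Import Defs.
From mathcomp Require Import all_boot all_classical topology.

(** Both directions rest on the compact clopen sets of [X], which form a base of
    its topology because [X] is locally compact and has a base of clopen sets.

    Suppose that [f] is a dense embedding. A clopen set of [Y] is determined by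
    its trace on a dense set, so [G |-> f @^-1` G] is injective. If [K] is a
    compact clopen set of [X], then [f @` K] is compact, hence closed, and it is
    the trace on [range f] of some open [V]; density puts [V] inside the closure
    of that trace, so [V = f @` K] ([dense_embedding_open_image]). Hence
    [f @` K] is compact clopen, and its preimage is [K].

    Conversely, if taking preimages is injective on clopen sets, no nonempty
    clopen set of [Y] has an empty preimage, so [f] has dense range. If every
    compact clopen set of [X] is moreover the preimage of an open set of [Y],
    then a base of [X], and therefore every open set of [X], is pulled back from
    [Y]: the topology of [X] is the initial topology of [f]. This makes [f] an
    embedding, since [X] is Hausdorff ([embeddingP]). *)

Local Open Scope classical_set_scope.

Section Embeddings.
Context {X Y : topologicalType}.
Implicit Types f : X -> Y.

(** This form replaces the inverse homeomorphism on [range f] by the condition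
    that the topology of [X] be pulled back from [Y]. *)
Lemma embeddingP f :
  embedding f <->
  [/\ continuous f, injective f &
      forall U, open U -> exists2 V, open V & f @^-1` V = U].
Proof.
split=> [[ch [g [cg hK gK]]]|[cf injf ini]].
- split.
  + apply/continuousP => V oV; move/continuousP: ch.
    by move=> /(_ (set_val @^-1` V)); apply; exists V.
  + move=> x y fxy; apply: (can_inj hK).
    exact: val_inj.
  + move=> U oU; move/continuousP: cg => /(_ U oU)[V oV VE]; exists V => //.
    rewrite -[LHS]/(to_range f @^-1` (set_val @^-1` V)) VE.
    by apply/seteqP; split=> x /=; rewrite hK.
- split; first by apply/continuousP => _ [V oV <-]; move/continuousP: cf; apply.
  have ex (y : range f) : exists x, f x = set_val y.
    by have [x _ xy] := set_valP y; exists x.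
  pose g y := sval (cid (ex y)).
  have fg y : f (g y) = set_val y by exact: svalP (cid (ex y)).
  exists g; split.
  + apply/continuousP => U /ini[V oV <-]; exists V => //.
    by apply/seteqP; split=> y /=; rewrite fg.
  + by move=> x; apply: injf; rewrite fg.
  + by move=> y; apply: val_inj; exact: fg.
Qed.

(** It suffices to pull back a base: the open sets of [Y] are closed under
    unions, and preimages commute with unions. In a Hausdorff space the open
    sets separate points, so that pulling them back along [f] forces
    injectivity. *)
Lemma embedding_basis f (B : set (set X)) :
  hausdorff_space X -> continuous f -> basis B ->
  (forall K, B K -> exists2 V, open V & f @^-1` V = K) -> embedding f.
Proof.
move=> hX cf [Bo Bb] BV.
have ini U : open U -> exists2 V, open V & f @^-1` V = U.
  move=> oU; exists (\bigcup_(V in [set V | open V /\ f @^-1` V `<=` U]) V).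
    by apply: bigcup_open => V [].
  apply/seteqP; split=> [x [V [_ VU] Vfx]|x Ux]; first exact: VU.
  have [K [BK Kx] KU] := Bb x U (open_nbhs_nbhs (conj oU Ux)).
  have [V oV VK] := BV K BK; exists V; last by rewrite -[V _]/((f @^-1` V) x) VK.
  by split=> //; rewrite VK.
apply/embeddingP; split=> // x y fxy; apply: hX => A C Ax Cy.
have [U [oU Ux] UA] : exists2 U, open_nbhs x U & U `<=` A.
  by move: Ax; rewrite nbhsE.
have [V oV VU] := ini U oU; exists y; split; last exact: nbhs_singleton.
by apply: UA; move: Ux; rewrite -VU /= fxy.
Qed.

(** The image of [K] is the trace on the range of an open set [V]. Since the
    range is dense, [V] lies in the closure of its trace, that is, in the closed
    set [f @` K]. *)
Lemma dense_embedding_open_image f (K : set X) :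
  hausdorff_space Y -> dense_embedding f -> compact K -> open K ->
  open (f @` K).
Proof.
move=> hY [/embeddingP[cf injf ini] df] kK oK.
have cfK : closed (f @` K).
  apply: compact_closed hY _.
  by apply: continuous_compact kK; exact: continuous_subspaceT.
have [V oV VK] := ini K oK.
suff -> : f @` K = V by [].
apply/seteqP; split=> [_ [x Kx <-]|y Vy]; first by move: Kx; rewrite -VK.
apply: cfK => W Wy.
have : nbhs y (V `&` W°).
  apply: filterI; first exact: open_nbhs_nbhs.
  by apply: open_nbhs_nbhs; split; [exact: open_interior | exact: Wy].
move=> /nbhs_singleton VWy.
have [|z [[Vz Wz] [x _ xz]]] := df (V `&` W°) (ex_intro _ y VWy).
  by apply: openI => //; exact: open_interior.
exists z; split; last exact: interior_subset Wz.
by exists x => //; rewrite -VK /= xz.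
Qed.

End Embeddings.

(** Around a point, shrink a compact neighborhood to a clopen set, which is
    compact as a closed subset of a compact set. *)
Lemma compact_clopen_basis (X : topologicalType) :
  clopen_based X -> locally_compact [set: X] ->
  basis [set K : set X | clopen K /\ compact K].
Proof.
move=> [_ Xb] lcX; split=> [K [[]]//|x U Ux].
have [C Cx [kC _]] := lcX x I.
have [|K [cK Kx] KUC] := Xb x (U `&` C).
  by apply: filterI => //; move: Cx; rewrite withinET.
exists K; last by move=> z /KUC[].
split=> //; split=> //; apply: (subclosed_compact _ kC); first by case: cK.
by move=> z /KUC[].
Qed.

Section PreimageOfClopens.
Context {X Y : topologicalType} {f : X -> Y} (cf : continuous f).

(** Clopen sets with the same trace on a dense set coincide, because their
    differences are open and miss the dense set. *)
Lemma Theta_t_inj : dense (range f) -> injective (Theta_t cf).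
Proof.
move=> df G H GH.
have {}GH : f @^-1` set_val G = f @^-1` set_val H by exact: (congr1 set_val GH).
have sub (G' H' : CO Y) : f @^-1` set_val G' = f @^-1` set_val H' ->
    set_val G' `<=` set_val H'.
  move=> E y Gy; apply: contrapT => nHy.
  have [oG _] := set_valP G'; have [_ cH] := set_valP H'.
  have [|z [[Gz nHz] [x _ xE]]] := df (set_val G' `&` ~` set_val H')
      (ex_intro _ y (conj Gy nHy)).
    by apply: openI => //; exact: closed_openC.
  apply: nHz; rewrite -xE -[set_val H' _]/((f @^-1` set_val H') x) -E.
  by rewrite /= xE.
by apply: val_inj; apply/seteqP; split; apply: sub.
Qed.

(** A clopen set that misses the range has the same preimage as [set0]. *)
Lemma Theta_t_inj_dense :
  clopen_based Y -> injective (Theta_t cf) -> dense (range f).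
Proof.
move=> [_ Yb] inj O [y Oy] oO.
have [G [cG Gy] GO] := Yb y O (open_nbhs_nbhs (conj oO Oy)).
apply: contrapT => nO.
pose G' : CO Y := SigSub (mem_set cG : G \in CO Y).
pose E : CO Y := SigSub (mem_set clopen0 : set0 \in CO Y).
suff /inj/(congr1 set_val) : Theta_t cf G' = Theta_t cf E.
  by rewrite !set_valE /= => GE; move: Gy; rewrite GE.
apply: val_inj; apply/seteqP; split=> x //=.
rewrite set_valE /= => Gx.
by apply: nO; exists (f x); split; [exact: GO | exists x].
Qed.

End PreimageOfClopens.

Theorem theorem3p28 (X Y : topologicalType)
    (zX : clopen_based X) (lcX : locally_compact [set: X])
    (hX : hausdorff_space X)
    (zY : clopen_based Y) (lcY : locally_compact [set: Y])
    (hY : hausdorff_space Y)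
    (f : X -> Y) (cf : continuous f) :
  dense_embedding f <->
  injective (Theta_t cf) /\ CK X `<=` Theta_t cf @` CK Y.
Proof.
split=> [ef|[inj CKs]].
- have [/embeddingP[_ injf _] df] := ef.
  split=> [|K kK]; first exact: Theta_t_inj.
  have [oK _] := set_valP K.
  have kfK : compact (f @` set_val K).
    by apply: continuous_compact kK; exact: continuous_subspaceT.
  have cfK : clopen (f @` set_val K).
    split; last exact: compact_closed hY kfK.
    exact: dense_embedding_open_image.
  exists (SigSub (mem_set cfK : _ \in CO Y)); first exact: kfK.
  apply: val_inj; apply/seteqP; split=> x /=; rewrite set_valE /=.
    by move=> [z Kz /injf <-].
  by move=> Kx; exists x.
- split; last exact: Theta_t_inj_dense zY inj.
  apply: (embedding_basis f _ hX cf (compact_clopen_basis _ zX lcX)).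
  move=> K [cK kK].
  have [G _ GK] := CKs (SigSub (mem_set cK : K \in CO X)) kK.
  exists (set_val G); first by have [] := set_valP G.
  exact: (congr1 set_val GK).
Qed.
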